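(* Let $F_1,F_2$ be polynomials with real coefficients, let $G,M>0$, $\kappa^2=32\pi G$, and define the real polynomials $$Q_0(x)=1-\kappa^2x\,[F_2(-x)+3F_1(-x)],\qquad Q_2(x)=1+\tfrac{\kappa^2x}{2}F_2(-x).$$ Assume that $Q_0$ and $Q_2$ are both nonconstant and that neither has a root in $(-\infty,0)$. The degrees of $Q_0$ and $Q_2$ need not be equal, and their roots may be real or complex and of arbitrary multiplicity. For $r>0$ let $$\phi(r)=\frac{iGM}{\pi r}\ \mathrm{p.v.}\!\int_{-\infty}^{+\infty}\frac{dk}{k}\,e^{ikr}\left(\frac{4}{3\,Q_2(-k^2)}-\frac{1}{3\,Q_0(-k^2)}\right),$$ and for $i\in\{0,2\}$ let $$C_i(r)=1-\frac{1}{i_{\mathbb C}\,\pi}\ \mathrm{p.v.}\!\int_{-\infty}^{+\infty}\frac{e^{i_{\mathbb C}kr}}{k\,Q_i(-k^2)}\,dk ,$$ where $i_{\mathbb C}$ denotes the imaginary unit (written $i$ in the formula for $\phi$). Then, for all $r>0$, $$\phi(r)=-\frac{GM}{r}\left[1-\frac43C_2(r)+\frac13C_0(r)\right],$$ the values $C_0(r),C_2(r)$ and $\phi(r)$ are real, and $C_i(r)=1+\mathcal O(r)$ as $r\to0^+$ for $i=0,2$. The potential $\phi$ is regular at the origin, i.e. $\lim_{r\to0^+}\phi(r)$ exists and is finite.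
   Context: The function $\phi$ is the modified Newtonian potential of a static point mass $M$ in the linearized higher-derivative gravity theory with Lagrangian $\sqrt{-g}\,\big(\tfrac{2}{\kappa^2}R+R\,F_1(\square)R+R_{\mu\nu}F_2(\square)R^{\mu\nu}\big)$. The roots of $Q_2$ and $Q_0$ are the squared masses of the massive spin-2 and spin-0 modes, respectively. The absence of roots in $(-\infty,0)$ expresses the absence of tachyonic modes, and ensures $Q_i(-k^2)\neq0$ for all real $k$ (note $Q_i(0)=1$). The symbol p.v. denotes the Cauchy principal value at $k=0$. *)

(* Defs.v *)
From HB Require Import structures.
From mathcomp Require Import all_boot all_order all_algebra.
From mathcomp Require Import all_classical all_reals all_analysis.
From mathcomp Require Import complex.

Set Implicit Arguments.
Unset Strict Implicit.
Unset Printing Implicit Defensive.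

Import Order.TTheory GRing.Theory Num.Theory numFieldNormedType.Exports.

Local Open Scope classical_set_scope.
Local Open Scope ring_scope.
Local Open Scope complex_scope.

(* R[i] seen as a numFieldType, so that it carries its usual topology. *)
Definition Cplx (R : realType) : numFieldType := R[i].

Definition cexp (R : realType) (z : Cplx R) : Cplx R :=
  (expR (complex.Re z))%:C * (cos (complex.Im z) +i* sin (complex.Im z)).

Definition Cintegrable (R : realType) (D : set R) (f : R -> Cplx R) : Prop :=
  (@lebesgue_measure R).-integrable D (EFin \o (fun k => complex.Re (f k))) /\
  (@lebesgue_measure R).-integrable D (EFin \o (fun k => complex.Im (f k))).

Definition Cintegral (R : realType) (D : set R) (f : R -> Cplx R) : Cplx R :=
  (\int[@lebesgue_measure R]_(k in D) complex.Re (f k)) +i*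
  (\int[@lebesgue_measure R]_(k in D) complex.Im (f k)).

(* Principal value at 0 only: at infinity the integral is an absolutely
   convergent Lebesgue integral. *)
Definition pv_trunc (R : realType) (f : R -> Cplx R) (eps : R) : Cplx R :=
  Cintegral [set k : R | eps <= `|k|] f.

Definition pv_cvg (R : realType) (f : R -> Cplx R) : Prop :=
  (forall eps : R, 0 < eps -> Cintegrable [set k : R | eps <= `|k|] f) /\
  cvg (pv_trunc f eps @[eps --> 0^'+]).

(* Meaningful only under pv_cvg f: Cintegral and lim are total and return
   unspecified values otherwise. *)
Definition pv_integral (R : realType) (f : R -> Cplx R) : Cplx R :=
  lim (pv_trunc f eps @[eps --> 0^'+]).

Definition Q0 (R : realType) (kappa : R) (F1 F2 : {poly R}) : {poly R} :=
  1 - (kappa ^+ 2) *: 'X * (F2 \Po (- 'X) + 3 *: (F1 \Po (- 'X))).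

Definition Q2 (R : realType) (kappa : R) (F2 : {poly R}) : {poly R} :=
  1 + (kappa ^+ 2 / 2) *: 'X * (F2 \Po (- 'X)).

Definition phi_integrand (R : realType) (q0 q2 : {poly R}) (r k : R) : Cplx R :=
  (k%:C)^-1 * cexp ('i%C * (k * r)%:C) *
  (4 / (3 * q2.[- k ^+ 2]) - 1 / (3 * q0.[- k ^+ 2]))%:C.

Definition phi (R : realType) (G M : R) (q0 q2 : {poly R}) (r : R) : Cplx R :=
  'i%C * (G * M)%:C / (pi * r)%:C * pv_integral (phi_integrand q0 q2 r).

Definition C_integrand (R : realType) (q : {poly R}) (r k : R) : Cplx R :=
  cexp ('i%C * (k * r)%:C) / (k * q.[- k ^+ 2])%:C.

Definition C_ (R : realType) (q : {poly R}) (r : R) : Cplx R :=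
  1 - ('i%C * pi%:C)^-1 * pv_integral (C_integrand q r).

(* Main.v *)
(** Put P(k) = 1 / q(-k^2). Since q is nonconstant, q(0) = 1 and q has no negative
    root, P is even and dominated by a multiple of 1 / (1 + k^2). The real part
    cos(kr) P(k) / k of the integrand is odd and cancels on every symmetric
    truncation, while |sin(kr) / k| <= r makes the imaginary part absolutely
    integrable across k = 0. Hence the principal value is i S(r) with
      S(r) = int sin(kr) / k * P(k) dk,
    which is real and at most r * int |P|, and dominated convergence shows that
    S(r) / r has a limit as r -> 0+. Both C_i = 1 - S_i / pi and
    phi = - GM / pi * (4/3 S_2 - 1/3 S_0) / r are read off from this. *)

Require Import Defs.
From mathcomp Require Import all_boot all_order all_algebra.
From mathcomp Require Import all_classical all_reals all_analysis.
From mathcomp Require Import measurable_realfun complex polyrcf.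
From mathcomp Require Import ring lra.

Import Order.TTheory GRing.Theory Num.Theory numFieldNormedType.Exports.

Local Open Scope classical_set_scope.
Local Open Scope ring_scope.
Local Open Scope complex_scope.

Section EvenDominatedKernels.
Context {R : realType}.
Implicit Types (p q : {poly R}) (f g P : R -> R).
Local Notation mu := (@lebesgue_measure R).

(** * Lower bounds for polynomials on the half-line *)

(** With [c] half the leading coefficient, [p - c *: (1 + 'X)] keeps a positive leading coefficient
    even in degree one, where the subtraction reaches the leading term. It is therefore positive
    near infinity. *)
Lemma poly_ge_affine_near_pinfty p : (1 < size p)%N -> 0 < lead_coef p ->
  exists2 c : R, 0 < c & exists n, forall t, n <= t -> c * (1 + t) <= p.[t].
Proof.
move=> sp lp; set c := lead_coef p / 2; have c0 : 0 < c by rewrite divr_gt0.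
exists c => //; pose g := p - c *: (1 + 'X).
suff g0 : 0 < lead_coef g.
  have [n gn] := poly_pinfty_gt_lc g0; exists n => t /gn.
  rewrite !hornerE; lra.
have s1X : size (1 + 'X : {poly R}) = 2%N by rewrite addrC size_XaddC.
have [s2|s2] := eqVneq (size p) 2%N.
  have -> : lead_coef g = c.
    have g1 : g`_1 = c.
      rewrite coefB coefZ coefD coef1 coefX /= /c /lead_coef s2 /=; lra.
    have sg : size g = 2%N.
      apply/eqP; rewrite eqn_leq; apply/andP; split.
        by apply: (leq_trans (size_polyD _ _)); rewrite size_polyN size_scale ?gt_eqF// s2 s1X.
      rewrite ltnNge; apply: contraTN (c0) => /leq_sizeP/(_ 1%N (leqnn _)).
      by rewrite g1 => ->; rewrite ltxx.
    by rewrite /lead_coef sg.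
  by [].
rewrite lead_coefDl// size_polyN size_scale ?gt_eqF// s1X.
by rewrite ltn_neqAle eq_sym s2.
Qed.

Lemma norm_poly_ge_affine p : (1 < size p)%N ->
  (forall t, 0 <= t -> ~~ root p t) ->
  exists2 c : R, 0 < c & forall t, 0 <= t -> c * (1 + t) <= `|p.[t]|.
Proof.
wlog lp : p / 0 < lead_coef p => [H sp np|].
  have [lp|lp] := ltP 0 (lead_coef p); first exact: H.
  have lN : 0 < lead_coef (- p).
    rewrite lead_coefN oppr_gt0 lt_neqAle lp lead_coef_eq0 andbT.
    by apply: contraTneq sp => ->; rewrite size_poly0.
  have [||c c0 Hc] := H (- p) lN; first by rewrite size_polyN.
    by move=> t t0; rewrite rootN np.
  by exists c => // t /Hc; rewrite hornerN normrN.
move=> sp np; have [c c0 [n Hn]] := poly_ge_affine_near_pinfty p sp lp.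
pose N := Num.max n 0; have N0 : 0 <= N by rewrite le_max lexx orbT.
have cf : {within `[0, N], continuous (fun t => `|p.[t]|)}.
  apply: continuous_subspaceT => x; apply: continuous_comp.
    exact: continuous_horner.
  exact: norm_continuous.
have [d /[!in_itv]/= /andP[d0 _] dmin] := EVT_min N0 cf.
have m0 : 0 < `|p.[d]| by rewrite normr_gt0; exact: np.
(* Beyond [N] the growth rate [c] applies. On [[0, N]] the norm is at least its minimum, attained at
   [d] and nonzero for lack of roots, while [1 + t <= 1 + N]. *)
exists (Num.min c (`|p.[d]| / (1 + N))) => [|t t0].
  by rewrite lt_min c0 divr_gt0// ltr_wpDr.
have t1 : 0 <= 1 + t by rewrite addr_ge0.
have [Nt|tN] := leP N t.
  apply: le_trans (ler_norm _); apply: le_trans (Hn t _).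
    by rewrite ler_wpM2r// ge_min lexx.
  by apply: le_trans Nt; rewrite le_max lexx.
apply: (@le_trans _ _ (`|p.[d]| / (1 + N) * (1 + t))).
  by rewrite ler_wpM2r// ge_min lexx orbT.
apply: (@le_trans _ _ `|p.[d]|).
  rewrite mulrAC ler_pdivrMr ?ltr_wpDr// ler_wpM2l ?normr_ge0// lerD2l; exact: ltW.
by apply: dmin; rewrite in_itv/= t0 ltW.
Qed.

(** * Measurability, odd integrands and dominated convergence *)

Lemma measurable_invr : measurable_fun [set: R] (@GRing.inv R).
Proof.
(* Squaring makes the base of the real power nonnegative; at 0 both sides vanish because
   [0^-1 = 0]. *)
have -> : @GRing.inv R = (fun x => x * (x ^+ 2) `^ (-1)).
  apply/funext => x; rewrite powR_inv1 ?sqr_ge0// expr2.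
  have [->|x0] := eqVneq x 0; first by rewrite invr0 mul0r.
  by rewrite invfM mulrA divff// mul1r.
apply: measurable_funM => //.
exact: (measurableT_comp (measurable_powR _) (exprn_measurable 2)).
Qed.

Lemma integrable_oneDsqrV : mu.-integrable setT (fun x : R => ((oneDsqr x)^-1)%:E).
Proof.
apply/integrableP; split.
  apply/measurable_EFinP; apply: continuous_measurable_fun.
  exact: continuous_oneDsqrV.
have V0 x : 0 <= (oneDsqr x)^-1 :> R.
  by rewrite invr_ge0 (le_trans _ (oneDsqr_ge1 _)).
under eq_integral do rewrite /= ger0_norm//.
rewrite ge0_symfun_integralT//.
- rewrite -set_itvcy integral0y_oneDsqr -EFinM ltry//.
- exact: continuous_oneDsqrV.
- by move=> x; rewrite /= /oneDsqr sqrrN.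
Qed.

(** Lebesgue measure is its own pushforward under negation, so the integral equals its opposite. *)
Lemma Rintegral_odd (D : set R) f : measurable D -> (-%R @^-1` D = D) ->
  measurable_fun setT f -> mu.-integrable D (EFin \o f) ->
  (forall x, f (- x) = - f x) -> \int[mu]_(x in D) f x = 0.
Proof.
move=> mD DN mf fi fN.
suff : \int[mu]_(x in D) f x = - \int[mu]_(x in D) f x by lra.
rewrite -[RHS]mulN1r -RintegralZl// /Rintegral; congr fine.
transitivity
    (\int[pushforward mu (-%R : _ -> measurableTypeR R)]_(x in D) (f x)%:E)%E.
  by apply: eq_measure_integral => //= A mA _; exact/esym/lebesgue_measureN.
rewrite integral_pushforward//= ?DN//.
- by apply: eq_integral => x _ /=; rewrite fN mulN1r.
- exact/measurable_EFinP.
- have -> : (EFin \o f) \o -%R = (fun x => (-1)%:E * (EFin \o f) x)%E.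
    by apply/funext => x /=; rewrite fN -EFinM mulN1r.
  exact: integrableZl.
Qed.

(** A right limit at 0 can be tested along sequences of positive reals tending to 0, which reduces
    this to sequential dominated convergence. *)
Lemma dominated_cvg_at_right (F : R -> R -> R) f g :
  (forall t, 0 < t -> measurable_fun setT (F t)) -> measurable_fun setT f ->
  mu.-integrable setT (EFin \o g) ->
  (forall x, F t x @[t --> 0^'+] --> f x) ->
  (forall t x, 0 < t -> `|F t x| <= g x) ->
  \int[mu]_x F t x @[t --> 0^'+] --> \int[mu]_x f x.
Proof.
move=> mF mf ig Ff Fg; apply/cvg_at_rightP => u [u0 ucvg].
have [||||| fi _ cvgI] := @dominated_convergence _ _ _ mu setT measurableT
  (fun n x => (F (u n) x)%:E) (EFin \o f) (EFin \o g).
- by move=> n; apply/measurable_EFinP; exact: mF.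
- exact/measurable_EFinP.
- apply: aeW => x _; apply: cvg_EFin; first exact: nearW.
  have /cvg_at_rightP := Ff x; exact.
- exact: ig.
- by apply: aeW => x n _ /=; rewrite lee_fin Fg.
- apply: fine_cvg; rewrite fineK//; exact: integrable_fin_num.
Qed.

(** * Elementary facts on the sine and on symmetric truncations *)

Lemma norm_sin_le (x : R) : `|sin x| <= `|x|.
Proof.
wlog x0 : x / 0 < x => [H|].
  have [x0|x0|->] := ltgtP x 0; [|exact: H|by rewrite sin0].
  by rewrite -normrN -sinN -(normrN x) H// oppr_gt0.
have [|c _] := @MVT R sin cos 0 x x0.
- by apply: continuous_subspaceT; exact: continuous_sin.
- rewrite sin0 !subr0 => ->; rewrite normrM ler_piMl//.
  exact: cos_max.
Qed.

(** This quotient is the difference quotient at 0 of [sin (k * r)] as a function of [r]. *)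
Lemma cvg_sin_mulr (k : R) : sin (k * r) / r @[r --> 0^'+] --> k.
Proof.
have D : is_derive (0 : R) 1 (fun r => sin (k * r)) (k * cos (k * 0)).
  by apply: is_derive_eq; rewrite /GRing.scale/=; ring.
have [df] := D; rewrite mulr0 cos0 mulr1 => Dk.
apply: cvg_dnbhs_at_right; rewrite -[X in _ --> X]Dk.
apply: cvg_trans df; apply: near_eq_cvg; apply: nearW => h /=.
by rewrite mulr0 sin0 subr0 addr0 /GRing.scale/= mulr1 mulrC.
Qed.

Lemma preimage_opp_normr_ge (eps : R) :
  -%R @^-1` [set k : R | eps <= `|k|] = [set k : R | eps <= `|k|].
Proof. by apply/seteqP; split => k /=; rewrite normrN. Qed.

Lemma measurable_normr_ge (eps : R) : measurable [set k : R | eps <= `|k|].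
Proof.
rewrite (_ : mkset _ = (@Num.norm R R) @^-1` `[eps, +oo[); last first.
  by apply/seteqP; split => x /=; rewrite in_itv/= andbT.
rewrite -[X in measurable X]setTI; apply: normr_measurable => //.
Qed.

(** * Even dominated functions and their sine integrals *)

(** This class contains each [1 / q(-k^2)] and is stable under linear combinations, so the same
    lemmas serve [C_] and [phi]. *)
Definition even_dominated P := [/\ measurable_fun setT P,
  forall k, P (- k) = P k &
  exists B : R, forall k, `|P k| <= B * (oneDsqr k)^-1].

Definition sine_integral P (r : R) : R := \int[mu]_k (k^-1 * sin (k * r) * P k).

Lemma even_dominated_mul_integrable (D : set R) P g (A : R) : even_dominated P ->
  measurable D -> measurable_fun setT g -> (forall k, D k -> `|g k| <= A) ->
  mu.-integrable D (EFin \o (fun k => g k * P k)).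
Proof.
move=> [mP _ [B PB]] mD mg gA.
(* The bound [A] on [g] and the bound [B / (1 + k^2)] on [P] multiply to an integrable majorant. *)
apply: (@le_integrable _ _ _ mu D mD _ (fun k => (A * B)%:E * ((oneDsqr k)^-1)%:E)%E).
- apply/measurable_EFinP; apply: measurable_funTS; exact: measurable_funM.
- move=> k Dk; rewrite -EFinM /= lee_fin normrM; apply: le_trans (ler_norm _).
  rewrite -mulrA; apply: ler_pM => //; exact: gA.
- apply: integrableZl => //; apply: integrableS integrable_oneDsqrV => //.
Qed.

Lemma even_dominated_integrableT P : even_dominated P ->
  mu.-integrable setT (EFin \o P).
Proof.
move=> hP.
rewrite (_ : P = fun k => cst 1 k * P k); last by apply/funext => k /=; rewrite mul1r.
by apply: (even_dominated_mul_integrable _ _ _ 1) => // k _ /=; rewrite normr1.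
Qed.

Lemma measurable_sine_kernel (r : R) :
  measurable_fun setT (fun k : R => k^-1 * sin (k * r)).
Proof.
apply: measurable_funM; first exact: measurable_invr.
apply: continuous_measurable_fun => x; apply: continuous_comp.
  exact: mulrr_continuous.
exact: continuous_sin.
Qed.

Lemma measurable_cosine_kernel (r : R) :
  measurable_fun setT (fun k : R => k^-1 * cos (k * r)).
Proof.
apply: measurable_funM; first exact: measurable_invr.
apply: continuous_measurable_fun => x; apply: continuous_comp.
  exact: mulrr_continuous.
exact: continuous_cos.
Qed.

(* At k = 0 the left-hand side is 0 because 0^-1 = 0. *)
Lemma sine_kernel_le (r k : R) : `|k^-1 * sin (k * r)| <= `|r|.
Proof.
have [->|k0] := eqVneq k 0; first by rewrite invr0 mul0r normr0.
rewrite normrM normfV mulrC ler_pdivrMr ?normr_gt0//.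
by rewrite mulrC -normrM norm_sin_le.
Qed.

Lemma cosine_kernel_le (eps r k : R) : 0 < eps -> eps <= `|k| ->
  `|k^-1 * cos (k * r)| <= eps^-1.
Proof.
move=> e0 ek; rewrite normrM -[leRHS]mulr1; apply: ler_pM => //.
  by rewrite normfV lef_pV2// posrE (lt_le_trans e0).
exact: cos_max.
Qed.

Lemma sine_kernel_integrable (D : set R) P r : even_dominated P -> measurable D ->
  mu.-integrable D (EFin \o (fun k => k^-1 * sin (k * r) * P k)).
Proof.
move=> hP mD; apply: (even_dominated_mul_integrable D P _ `|r|) => //.
- exact: measurable_sine_kernel.
- by move=> k _; exact: sine_kernel_le.
Qed.

Lemma sine_integral_trunc_cvg P (r : R) : even_dominated P ->
  \int[mu]_(k in [set k : R | eps <= `|k|]) (k^-1 * sin (k * r) * P k)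
    @[eps --> 0^'+] --> sine_integral P r.
Proof.
move=> hP; have [mP _ _] := hP.
under eq_fun do rewrite Rintegral_mkcond.
have mf : measurable_fun setT (fun k : R => k^-1 * sin (k * r) * P k).
  by apply: measurable_funM => //; exact: measurable_sine_kernel.
apply: (dominated_cvg_at_right _ _ (fun k => `|k^-1 * sin (k * r) * P k|)) => //.
- move=> t t0; apply/(measurable_restrictT _ _).1.
    exact: measurable_normr_ge.
  exact: measurable_funTS.
- have := integrable_norm (sine_kernel_integrable setT P r hP measurableT).
  exact.
(* At [k = 0] the integrand is 0 by the convention on [0^-1]. At any other [k] the truncated
   integrand equals the full one as soon as [eps <= |k|]. *)
- move=> k; have [->|k0] := eqVneq k 0.
    under eq_fun do rewrite patchE.
    rewrite invr0 mul0r mul0r.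
    under eq_fun do rewrite if_same.
    exact: cvg_cst.
  apply: (cvg_near_cst) => //.
  near=> t; rewrite patchE mem_set//=; near: t.
  by apply: nbhs_right_le; rewrite normr_gt0.
- move=> t k t0; rewrite patchE; case: ifP => // _; rewrite normr0//.
Unshelve. all: by end_near. Qed.

Lemma sine_integral_le P : even_dominated P ->
  exists B, forall r, 0 < r -> `|sine_integral P r| <= B * r.
Proof.
move=> hP; exists (\int[mu]_k `|P k|).
have iP := even_dominated_integrableT P hP.
move=> r r0; apply: (le_trans (le_normr_Rintegral _ _)) => //.
  exact: sine_kernel_integrable.
rewrite mulrC -RintegralZl//; last exact: integrable_norm iP.
apply: le_Rintegral => //.
- exact: integrable_norm (sine_kernel_integrable setT P r hP measurableT).
- apply: (integrableZl (D := setT) measurableT r (integrable_norm iP)).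
- move=> k _; rewrite normrM ler_wpM2r//.
  by rewrite (le_trans (sine_kernel_le _ _))// gtr0_norm.
Qed.

Lemma sine_integral_div_cvg P : even_dominated P ->
  exists l : R, sine_integral P r / r @[r --> 0^'+] --> l.
Proof.
move=> hP; have [mP _ _] := hP.
(* The factor [k^-1 * k] is 1 except at [k = 0], so this is the integral of [P]; leaving it
   unsimplified makes the pointwise limit hold at 0 too. *)
exists (\int[mu]_k (k^-1 * k * P k)).
have iP := even_dominated_integrableT P hP.
rewrite (_ : (fun r => _) = (fun r => \int[mu]_k (k^-1 * (sin (k * r) / r) * P k))); last first.
  apply/funext => r; rewrite mulrC -RintegralZl//; last exact: sine_kernel_integrable.
  by apply: eq_Rintegral => k _; ring.
apply: (dominated_cvg_at_right _ _ (fun k => `|P k|)) => //.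
- move=> t _; under eq_fun do rewrite mulrA.
  apply: measurable_funM => //; apply: measurable_funM => //.
  exact: measurable_sine_kernel.
- apply: measurable_funM => //; apply: measurable_funM => //.
  exact: measurable_invr.
- exact: integrable_norm iP.
- move=> k; apply: cvgM; last exact: cvg_cst.
  by apply: cvgM; [exact: cvg_cst|exact: cvg_sin_mulr].
- move=> t k t0; rewrite normrM ler_piMl// mulrA normrM normfV (gtr0_norm t0).
  by rewrite ler_pdivrMr// mul1r (le_trans (sine_kernel_le _ _))// gtr0_norm.
Qed.

Lemma sine_integralB P1 P2 (a b r : R) : even_dominated P1 -> even_dominated P2 ->
  sine_integral (fun k => a * P1 k - b * P2 k) r =
  a * sine_integral P1 r - b * sine_integral P2 r.
Proof.
move=> h1 h2.
have i1 := sine_kernel_integrable setT P1 r h1 measurableT.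
have i2 := sine_kernel_integrable setT P2 r h2 measurableT.
rewrite /sine_integral -!RintegralZl// -RintegralB//.
- by apply: eq_Rintegral => k _; ring.
- exact: (integrableZl (D := setT) measurableT a i1).
- exact: (integrableZl (D := setT) measurableT b i2).
Qed.

Lemma even_dominatedB P1 P2 (a b : R) : even_dominated P1 -> even_dominated P2 ->
  even_dominated (fun k => a * P1 k - b * P2 k).
Proof.
move=> [m1 e1 [B1 h1]] [m2 e2 [B2 h2]]; split.
- by apply: measurable_funB; apply: measurable_funM.
- by move=> k; rewrite e1 e2.
exists (`|a| * B1 + `|b| * B2) => k.
apply: (@le_trans _ _ (`|a * P1 k| + `|b * P2 k|)); first exact: ler_normB.
by rewrite !normrM mulrDl -!mulrA lerD// ler_wpM2l.
Qed.

(** * Reciprocals of polynomials without negative roots *)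

Lemma even_dominated_poly q : (1 < size q)%N -> q.[0] != 0 ->
  (forall x, x < 0 -> ~~ root q x) -> even_dominated (fun k => (q.[- k ^+ 2])^-1).
Proof.
move=> sq q0 nq.
have nz k : q.[- k ^+ 2] != 0.
  have [->|k0] := eqVneq k 0; first by rewrite expr0n/= oppr0.
  by apply: nq; rewrite oppr_lt0 exprn_even_gt0.
split.
- apply: continuous_measurable_fun => k; apply: cvgV => //.
  apply: (@continuous_comp _ _ _ (fun x : R => - x ^+ 2) (horner q)); last exact: continuous_horner.
  by apply: cvgN; exact: exprn_continuous.
- by move=> k; rewrite sqrrN.
(* The half-line bound is applied to [q(-t)] and then read at [t = k^2]. *)
have [c c0 Hc] : exists2 c : R, 0 < c &
    forall t, 0 <= t -> c * (1 + t) <= `|(q \Po (- 'X)).[t]|.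
  apply: norm_poly_ge_affine.
    by rewrite size_comp_poly2// size_polyN size_polyX.
  move=> t t0; rewrite /root horner_comp hornerN hornerX.
  have [->|tn0] := eqVneq t 0; first by rewrite oppr0.
  by apply: nq; rewrite oppr_lt0 lt_def tn0.
exists c^-1 => k; rewrite normfV -invfM lef_pV2 ?posrE ?normr_gt0//.
  by have := Hc _ (sqr_ge0 k); rewrite horner_comp hornerN hornerX.
by rewrite mulr_gt0// (lt_le_trans ltr01)// oneDsqr_ge1.
Qed.

(** * Complex kernels and their principal values *)

Lemma norm_real_complex (x : R) : `|x%:C : Cplx R| = `|x|%:C.
Proof. by rewrite normc_def/= expr0n/= addr0 sqrtr_sqr. Qed.

(** In the partial order of [R[i]] a positive tolerance is real, so it can be replaced by its real
    part. *)
Lemma cvg_real_complex (T : Type) (F : set_system T) (FF : Filter F) (f : T -> R) (l : R) :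
  f x @[x --> F] --> l -> ((f x)%:C : Cplx R) @[x --> F] --> (l%:C : Cplx R).
Proof.
move=> /cvgrPdist_lt fl; apply/cvgrPdist_lt => e e0.
have eE : e = (complex.Re e)%:C by rewrite RRe_real// gtr0_real.
have e0' : 0 < complex.Re e by move: e0; rewrite eE ltcR.
apply: filterS (fl _ e0') => x; rewrite -rmorphB norm_real_complex eE ltcR//.
Qed.

Lemma cexp_i (x : R) : cexp ('i%C * x%:C) = (cos x +i* sin x).
Proof.
by rewrite /cexp; simpc; rewrite /= expR0; simpc.
Qed.

(** Common shape of [C_integrand] and [phi_integrand], which differ only in the choice of [P]. *)
Definition pv_kernel P (r k : R) : Cplx R :=
  (k%:C)^-1 * cexp ('i%C * (k * r)%:C) * (P k)%:C.

Lemma pv_kernelE P r : pv_kernel P r = fun k =>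
  (k^-1 * cos (k * r) * P k) +i* (k^-1 * sin (k * r) * P k).
Proof.
by apply/funext => k; rewrite /pv_kernel cexp_i -fmorphV/=; simpc.
Qed.

Lemma Cintegrable_pv_kernel P (r eps : R) : even_dominated P -> 0 < eps ->
  Cintegrable [set k : R | eps <= `|k|] (pv_kernel P r).
Proof.
move=> hP e0; rewrite pv_kernelE.
split.
  apply: (even_dominated_mul_integrable [set k : R | eps <= `|k|] P (fun k => k^-1 * cos (k * r)) eps^-1) => //.
  - exact: measurable_normr_ge.
  - exact: measurable_cosine_kernel.
  - by move=> k; exact: cosine_kernel_le.
by apply: sine_kernel_integrable => //; exact: measurable_normr_ge.
Qed.

Lemma pv_trunc_kernel P (r eps : R) : even_dominated P -> 0 < eps ->
  pv_trunc (pv_kernel P r) eps = 'i%C *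
  (\int[mu]_(k in [set k : R | eps <= `|k|]) (k^-1 * sin (k * r) * P k))%:C.
Proof.
move=> hP e0; have [iRe _] := Cintegrable_pv_kernel P r eps hP e0.
have [mP eP _] := hP.
rewrite /pv_trunc /Cintegral.
(* The first integral is the real part: its cosine kernel is odd, and the truncation domain is
   symmetric. *)
rewrite Rintegral_odd//.
- simpc; congr (_ +i* _); apply: eq_Rintegral => k _.
  by rewrite pv_kernelE.
- exact: measurable_normr_ge.
- exact: preimage_opp_normr_ge.
- rewrite pv_kernelE; apply: measurable_funM => //.
  exact: measurable_cosine_kernel.
- by move=> k; rewrite pv_kernelE/= eP invrN (mulNr k) cosN !mulNr.
Qed.

Lemma pv_trunc_kernel_cvg P (r : R) : even_dominated P ->
  pv_trunc (pv_kernel P r) eps @[eps --> 0^'+] -->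
    ('i%C * (sine_integral P r)%:C : Cplx R).
Proof.
move=> hP.
have H : ('i%C * (\int[mu]_(k in [set k : R | eps <= `|k|])
    (k^-1 * sin (k * r) * P k))%:C : Cplx R) @[eps --> 0^'+] -->
    ('i%C * (sine_integral P r)%:C : Cplx R).
  apply: cvgM; first exact: cvg_cst.
  by apply: cvg_real_complex; exact: sine_integral_trunc_cvg.
apply: cvg_trans H; apply: near_eq_cvg; near=> eps.
by rewrite pv_trunc_kernel.
Unshelve. all: by end_near. Qed.

Lemma pv_cvg_kernel P (r : R) : even_dominated P -> pv_cvg (pv_kernel P r).
Proof.
move=> hP; split; first by move=> eps; exact: Cintegrable_pv_kernel.
by apply/cvg_ex; exists ('i%C * (sine_integral P r)%:C); exact: pv_trunc_kernel_cvg.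
Qed.

Lemma pv_integral_kernel P (r : R) : even_dominated P ->
  pv_integral (pv_kernel P r) = 'i%C * (sine_integral P r)%:C.
Proof. by move=> hP; apply: norm_cvg_lim; exact: pv_trunc_kernel_cvg. Qed.

(** * Expressing [C_] and [phi] through real sine integrals *)

Lemma C_integrandE q r : C_integrand q r = pv_kernel (fun k => (q.[- k ^+ 2])^-1) r.
Proof.
apply/funext => k; rewrite /C_integrand /pv_kernel.
by set E := cexp _; rewrite -!fmorphV invfM rmorphM mulrCA mulrA.
Qed.

Lemma phi_integrandE q0 q2 r : phi_integrand q0 q2 r =
  pv_kernel (fun k => 4 / 3 * (q2.[- k ^+ 2])^-1 - 1 / 3 * (q0.[- k ^+ 2])^-1) r.
Proof.
apply/funext => k; rewrite /phi_integrand /pv_kernel.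
by rewrite !invfM !mulrA.
Qed.

Lemma C_E q r : even_dominated (fun k => (q.[- k ^+ 2])^-1) ->
  C_ q r = (1 - sine_integral (fun k => (q.[- k ^+ 2])^-1) r / pi)%:C.
Proof.
move=> hq; rewrite /C_ C_integrandE pv_integral_kernel//.
rewrite rmorphB rmorph1 rmorphM/= fmorphV; congr (_ - _).
have i0 : 'i%C != 0 :> Cplx R by rewrite eq_complex/= oner_eq0 andbF.
by rewrite invfM mulrC mulrACA divff// mul1r.
Qed.

(** The sign comes from ['i * 'i = -1]. Grouping the sine integral with [1 / r] isolates the
    quotient that converges at the origin. *)
Lemma phiE G M q0 q2 r :
  even_dominated (fun k => (q0.[- k ^+ 2])^-1) ->
  even_dominated (fun k => (q2.[- k ^+ 2])^-1) ->
  phi G M q0 q2 r = (- (G * M / pi) *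
   (sine_integral (fun k => 4 / 3 * (q2.[- k ^+ 2])^-1
                          - 1 / 3 * (q0.[- k ^+ 2])^-1) r / r))%:C.
Proof.
move=> h0 h2; rewrite /phi phi_integrandE pv_integral_kernel; last exact: even_dominatedB.
set S := sine_integral _ r.
rewrite -fmorphV mulrCA !mulrA -expr2 sqr_i mulN1r !mulNr -!rmorphM -rmorphN.
by congr (_ %:C); rewrite invfM; ring.
Qed.

Lemma C_bigO q : even_dominated (fun k => (q.[- k ^+ 2])^-1) ->
  C_ q = cst 1 +O_ (0^'+) (fun r : R => r%:C : Cplx R).
Proof.
move=> hq; have [B HB] := sine_integral_le _ hq.
have pi0 := pi_gt0 R.
apply/eqaddOP.
(* The big-O constant ranges over a neighbourhood of infinity in [R[i]], given by a real threshold;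
   every [k] above [B / pi] works, as [C_ q r - 1] is the sine integral over [-pi]. *)
exists (B / pi)%:C; split; first by apply/complex_realP; exists (B / pi).
move=> k Bk; near=> r.
have r0 : 0 < r by [].
apply: (@le_trans _ _ ((B / pi)%:C * `|r%:C|)); last by rewrite ler_wpM2r// ltW.
rewrite [X in `|X|](_ : _ = C_ q r - 1)// C_E// -(rmorph1 (real_complex R)) -rmorphB.
rewrite !norm_real_complex -rmorphM lecR addrAC subrr add0r normrN normrM normfV.
rewrite (gtr0_norm r0) (gtr0_norm pi0) mulrAC; apply: ler_wpM2r; last exact: HB.
by rewrite invr_ge0 ltW.
Unshelve. all: by end_near. Qed.

Lemma Q0_0 kappa (F1 F2 : {poly R}) : (Q0 kappa F1 F2).[0] = 1.
Proof. by rewrite /Q0 hornerD hornerN hornerM hornerZ hornerX hornerC mulr0 mul0r subr0. Qed.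

Lemma Q2_0 kappa (F2 : {poly R}) : (Q2 kappa F2).[0] = 1.
Proof. by rewrite /Q2 hornerD hornerM hornerZ hornerX hornerC mulr0 mul0r addr0. Qed.

End EvenDominatedKernels.

Theorem mainTheorem1 (R : realType) (G M kappa : R) (F1 F2 : {poly R})
    (G_gt0 : 0 < G) (M_gt0 : 0 < M)
    (kappaE : kappa ^+ 2 = 32 * pi * G)
    (Q0_nonconst : (1 < size (Q0 kappa F1 F2))%N)
    (Q2_nonconst : (1 < size (Q2 kappa F2))%N)
    (Q0_noroot : forall x : R, x < 0 -> ~~ root (Q0 kappa F1 F2) x)
    (Q2_noroot : forall x : R, x < 0 -> ~~ root (Q2 kappa F2) x) :
  let q0 := Q0 kappa F1 F2 in
  let q2 := Q2 kappa F2 in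
  [/\ (* the principal values defining phi, C_0 and C_2 exist *)
      forall r : R, 0 < r ->
        [/\ pv_cvg (phi_integrand q0 q2 r),
            pv_cvg (C_integrand q0 r)
          & pv_cvg (C_integrand q2 r)],
      forall r : R, 0 < r ->
        phi G M q0 q2 r =
          - (G * M / r)%:C * (1 - (4 / 3) * C_ q2 r + (1 / 3) * C_ q0 r),
      forall r : R, 0 < r ->
        [/\ C_ q0 r \is Num.real,
            C_ q2 r \is Num.real
          & phi G M q0 q2 r \is Num.real],
      C_ q0 = cst 1 +O_ (0^'+) (fun r : R => r%:C : Cplx R) /\
      C_ q2 = cst 1 +O_ (0^'+) (fun r : R => r%:C : Cplx R)
    & exists l : R, phi G M q0 q2 r @[r --> 0^'+] --> (l%:C : Cplx R)].
Proof.
move=> q0 q2.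
have h0 : even_dominated (fun k => (q0.[- k ^+ 2])^-1).
  by apply: even_dominated_poly => //; rewrite Q0_0 oner_neq0.
have h2 : even_dominated (fun k => (q2.[- k ^+ 2])^-1).
  by apply: even_dominated_poly => //; rewrite Q2_0 oner_neq0.
have pi0 : pi != 0 :> R by rewrite gt_eqF ?pi_gt0.
have real x : (x%:C : Cplx R) \is Num.real by apply/complex_realP; exists x.
split.
- move=> r _; rewrite phi_integrandE !C_integrandE.
  by split; apply: pv_cvg_kernel => //; exact: even_dominatedB.
(* Since [1 - 4/3 + 1/3 = 0], the constant terms of [C_] cancel and both sides are the same
   combination of [S2] and [S0]. *)
- move=> r r0; rewrite phiE// !C_E// sine_integralB//.
  set S2 := sine_integral _ r; set S0 := sine_integral _ r.
  have nat3 n : (n%:R : Cplx R) = (n%:R : R)%:C by rewrite rmorph_nat.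
  (* Gathering both sides under one embedding of [R] leaves an identity of real fractions. *)
  rewrite -(rmorph1 (real_complex R)) !nat3 -!fmorphV -!rmorphM -rmorphB -rmorphD -rmorphN -rmorphM.
  congr (_ %:C); move: (pi) pi0 => p p0; field; rewrite p0 gt_eqF//.
- by move=> r _; rewrite phiE// !C_E.
- by split; exact: C_bigO.
(* Regularity at the origin: the combined [P] of [phi] is itself even and dominated, so its sine
   integral over [r] converges. *)
have [l Hl] := sine_integral_div_cvg _ (even_dominatedB _ _ (4 / 3) (1 / 3) h2 h0).
exists (- (G * M / pi) * l).
under eq_fun do rewrite phiE//.
apply: cvg_real_complex; apply: cvgM => //; exact: cvg_cst.
Qed.
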